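(* Let $n\ge 1$ and let $k_1,\dots,k_n\ge 1$ be integers. Let $\mathcal{M}=\{1^{k_1},2^{k_2},\ldots,n^{k_n}\}$, let $K=k_1+k_2+\cdots+k_n$, and let $\mathcal{M}'=\{1^{K-n+1},2,3,\ldots,n\}$. There is a bijection $\Phi:\overline{\mathcal{Q}}_{\mathcal{M}}\to\overline{\mathcal{Q}}_{\mathcal{M}'}$ such that for every $\pi\in\overline{\mathcal{Q}}_{\mathcal{M}}$, $asc(\pi)=asc(\Phi(\pi))$, $des(\pi)=des(\Phi(\pi))$ and $plat(\pi)=plat(\Phi(\pi))$. Consequently, $\overline{Q}_{\mathcal{M}}(t,u,v)=\overline{Q}_{\mathcal{M}'}(t,u,v)$.
   Context: The notation $\{1^{k_1},\ldots,n^{k_n}\}$ denotes the multiset in which $i$ occurs exactly $k_i$ times (an element without exponent occurs once). A permutation of a multiset is a linear arrangement (word) of its elements in which each element is used with its multiplicity. A permutation $\pi$ of a multiset is quasi-Stirling if there do not exist indices $i<j<k<\ell$ with $\pi_i=\pi_k$ and $\pi_j=\pi_\ell$. $\overline{\mathcal{Q}}_{\mathcal{M}}$ is the set of quasi-Stirling permutations of the multiset $\mathcal{M}$. For a word $\pi=\pi_1\pi_2\cdots\pi_N$ of positive integers, with the convention $\pi_0=\pi_{N+1}=0$, an index $i$ with $0\le i\le N$ is an ascent (resp. descent, plateau) if $\pi_i<\pi_{i+1}$ (resp. $\pi_i>\pi_{i+1}$, $\pi_i=\pi_{i+1}$); $asc(\pi)$, $des(\pi)$, $plat(\pi)$ are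 the numbers of ascents, descents, plateaux. Finally $\overline{Q}_{\mathcal{M}}(t,u,v)=\sum_{\pi\in\overline{\mathcal{Q}}_{\mathcal{M}}}t^{des(\pi)}u^{asc(\pi)}v^{plat(\pi)}$.
   Formalization: Quasi-Stirling is taken with the two repeated letters distinct (π_i=π_k, π_j=π_ℓ and π_i≠π_j); without this, four equal letters are forbidden and the claim fails, e.g. for k=(3,3): 111222 is admissible but {1^5,2} has no admissible word. *)

(* Defs.v *)
From HB Require Import structures.
From mathcomp Require Import all_boot all_order all_algebra.
From mathcomp Require Import mpoly.

Set Implicit Arguments.
Unset Strict Implicit.
Unset Printing Implicit Defensive.

Import GRing.Theory.

(* The multiset {1^(k 1), ..., n^(k n)}, given by its weakly increasing
   arrangement; the values of k outside 1..n are irrelevant. *)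
Definition multiset (n : nat) (k : nat -> nat) : seq nat :=
  flatten [seq nseq (k i) i | i <- iota 1 n].

(* No i < j < k < l with w_i = w_k, w_j = w_l and w_i <> w_j: the two repeated
   letters are distinct, otherwise four equal letters would be excluded.
   Positions are counted from 0. *)
Definition quasi_stirling (w : seq nat) : bool :=
  ~~ [exists i : 'I_(size w), exists j : 'I_(size w),
      exists k : 'I_(size w), exists l : 'I_(size w),
        [&& i < j, j < k, k < l,
            nth 0 w i == nth 0 w k, nth 0 w j == nth 0 w l
          & nth 0 w i != nth 0 w j]].

(* Duplicate-free, as [permutations M] lists each arrangement of M once. *)
Definition QS (M : seq nat) : seq (seq nat) :=
  [seq w <- permutations M | quasi_stirling w].

(* w with the convention w_0 = w_(N+1) = 0; for 1 <= i <= N, the letter w_i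
   (counted from 1) is at position i of this sequence. *)
Definition padded (w : seq nat) : seq nat := 0 :: rcons w 0.

Definition asc (w : seq nat) : nat :=
  #|[set i : 'I_(size w).+1 | nth 0 (padded w) i < nth 0 (padded w) i.+1]|.

Definition des (w : seq nat) : nat :=
  #|[set i : 'I_(size w).+1 | nth 0 (padded w) i > nth 0 (padded w) i.+1]|.

Definition plat (w : seq nat) : nat :=
  #|[set i : 'I_(size w).+1 | nth 0 (padded w) i == nth 0 (padded w) i.+1]|.

Local Open Scope ring_scope.

Definition var_t : {mpoly int[3]} := 'X_(@Ordinal 3 0 isT).
Definition var_u : {mpoly int[3]} := 'X_(@Ordinal 3 1 isT).
Definition var_v : {mpoly int[3]} := 'X_(@Ordinal 3 2 isT).

Definition Qbar (M : seq nat) : {mpoly int[3]} :=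
  \sum_(w <- QS M) var_t ^+ des w * var_u ^+ asc w * var_v ^+ plat w.

(* Main.v *)
Require Import Defs.
From HB Require Import structures.
From mathcomp Require Import all_boot all_order all_algebra.
From mathcomp Require Import mpoly.
From mathcomp Require Import zify.

Set Implicit Arguments.
Unset Strict Implicit.
Unset Printing Implicit Defensive.

(** Put a letter [0] in front of a word [w] and read [0 :: w] cyclically.  The
conventions at both ends of [w] are then no longer special: ascents, descents
and plateaux are counts of cyclically consecutive pairs, and being
quasi-Stirling (no subword [a b a b] with [a != b]) is invariant under
rotation.  As [0] occurs once, the cyclic word determines [w].

Let [x] and [y] be two letters with [`|x - y| = 1], such that [x] occurs at
least twice and [y] at least once.  In a noncrossing cyclic word the
occurrences of [x] and those of [y] do not alternate, so exactly one cyclic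
factor has the form [x V x Y y] with [V] and [Y] free of [x] and [y].  Replace
it by [x Y y V y]: the branch [V] that hung on [x] now hangs on [y], and one
copy of [x] has become a [y] (see [slide]).
- The result is noncrossing, because the letters of [V], enclosed between two
  occurrences of [x], occur nowhere else ([slide_noncrossing]).
- The statistics do not change: apart from the order of the pieces, only the
  ends of [V] see a new neighbour, and they compare to [x] as they do to [y]
  since no third letter lies between or equals them ([slide_links]).
- The factor [x Y y] is again the only one of its kind, so the slide can be
  undone and is injective on cyclic words ([slide_inj]).

Hence there is an injection, compatible with the statistics, from the
quasi-Stirling permutations of [x :: A] to those of [y :: A].  The hypotheses
are symmetric in [x] and [y], so there is one in the other direction as well,
and the two finite sets have the same joint distribution
([equidistributed_transfer]).  Keep one copy of every letter fixed and lower
the surplus copies one unit at a time until they are all equal to [1]: this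
shows that the distribution depends only on [n] and on the total size
([equidistributed_multiset]).  Equality of the distributions gives both the
bijection and the equality of the generating polynomials. *)

(** * Splitting words *)

Lemma subseq_catP (T : eqType) (t A B : seq T) :
  subseq t (A ++ B) ->
  exists t1 t2, [/\ t = t1 ++ t2, subseq t1 A & subseq t2 B].
Proof.
case/subseqP=> m sz_m ->; exists (mask (take (size A) m) A).
exists (mask (drop (size A) m) B); split; try exact: mask_subseq.
by rewrite -mask_cat ?cat_take_drop // size_takel // sz_m size_cat leq_addr.
Qed.

Lemma split_first (T : eqType) (x : T) s :
  x \in s -> exists s1 s2, s = s1 ++ x :: s2 /\ x \notin s1.
Proof.
elim: s => // c s IHs; rewrite inE; case: eqVneq => [<- _|xc /= /IHs].
  by exists [::], s.
case=> s1 [s2 [-> xs1]]; exists (c :: s1), s2; split=> //.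
by rewrite inE negb_or xc.
Qed.

Lemma split_last (T : eqType) (x : T) s :
  x \in s -> exists s1 s2, s = s1 ++ x :: s2 /\ x \notin s2.
Proof.
rewrite -mem_rev => /split_first[s1 [s2 [/(canRL revK) -> xs1]]].
by exists (rev s2), (rev s1); rewrite mem_rev rev_cat rev_cons cat_rcons.
Qed.

Lemma split_first_inj (T : eqType) (y : T) s1 s2 t1 t2 :
  y \notin s1 -> y \notin t1 -> s1 ++ y :: s2 = t1 ++ y :: t2 ->
  s1 = t1 /\ s2 = t2.
Proof.
elim: s1 t1 => [|c s1 IHs] [|d t1] //=; rewrite ?inE ?negb_or.
- by move=> _ _ [].
- by move=> _ /andP[yd _] [e _]; rewrite e eqxx in yd.
- by move=> /andP[yc _] _ [e _]; rewrite e eqxx in yc.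
by move=> /andP[_ ys1] /andP[_ yt1] [-> /(IHs _ ys1 yt1)[-> ->]].
Qed.

Lemma mem_before (T : eqType) (x y : T) s1 s2 t1 t2 :
  x != y -> x \notin t1 -> s1 ++ x :: s2 = t1 ++ y :: t2 -> y \in s1.
Proof.
move=> xy; elim: s1 t1 => [|c s1 IHs] [|d t1] //=.
- by move=> _ [e _]; rewrite e eqxx in xy.
- by rewrite inE => /norP[xd _] [e _]; rewrite e eqxx in xd.
- by move=> _ [-> _]; rewrite mem_head.
by rewrite !inE => /norP[_ xt1] [_ /(IHs _ xt1) ->]; rewrite orbT.
Qed.

(** * Noncrossing words *)

Definition noncrossing (w : seq nat) :=
  forall a b, a != b -> ~~ subseq [:: a; b; a; b] w.

(** Peels off one letter of a subword while keeping track of its position in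
the whole word [w], so that iterating it yields increasing indices. *)
Lemma subseq_cons_dropP (a : nat) s m (w : seq nat) :
  reflect (exists i, [/\ m <= i, i < size w, nth 0 w i = a
                       & subseq s (drop i.+1 w)])
          (subseq (a :: s) (drop m w)).
Proof.
apply: (iffP idP) => [|[i [mi iw <- ss]]]; last first.
  apply: (@subseq_trans _ (drop i w)); last first.
    by rewrite -(subnK mi) -drop_drop drop_subseq.
  by rewrite (drop_nth 0 iw) /= eqxx.
move e: (size w - m) => d; elim: d m e => [|d IHd] m e.
  by rewrite drop_oversize //; lia.
have mw : m < size w by lia.
rewrite (drop_nth 0 mw) /=; case: eqP => [-> ss|_ /IHd].
  by exists m; rewrite leqnn.
by case=> [|i [mi iw ai ss]]; [lia|exists i; split=> //; lia].
Qed.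

Lemma quasi_stirlingP w : reflect (noncrossing w) (quasi_stirling w).
Proof.
apply: (iffP idP) => [qs a b ab|nc]; last first.
  apply/negP=> /existsP[i /existsP[j /existsP[k /existsP[l]]]].
  case/and5P=> ij jk kl /eqP eik /andP[/eqP ejl nij].
  have/negP[] := nc _ _ nij.
  suff: subseq [:: nth 0 w i; nth 0 w j; nth 0 w i; nth 0 w j] (drop 0 w).
    by rewrite drop0.
  apply/subseq_cons_dropP; exists i; split=> //.
  apply/subseq_cons_dropP; exists j; split=> //.
  apply/subseq_cons_dropP; exists k; split=> //.
  by apply/subseq_cons_dropP; exists l; split=> //; apply: sub0seq.
apply/negP; rewrite -(drop0 w).
case/subseq_cons_dropP=> i [_ iw ei].
case/subseq_cons_dropP=> j [ij jw ej].
case/subseq_cons_dropP=> k [jk kw ek].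
case/subseq_cons_dropP=> l [kl lw el _].
case/negP: qs; apply/existsP; exists (Ordinal iw).
apply/existsP; exists (Ordinal jw); apply/existsP; exists (Ordinal kw).
apply/existsP; exists (Ordinal lw); rewrite /= ei ej ek el !eqxx ab.
by rewrite ij jk kl.
Qed.

Lemma noncrossing_subseq v w : subseq v w -> noncrossing w -> noncrossing v.
Proof. by move=> vw nc a b /nc; apply/contra => /subseq_trans; apply. Qed.

(** A rotation turns the pattern [a b a b] into itself or into [b a b a]. *)
Lemma noncrossing_catC A B : noncrossing (A ++ B) -> noncrossing (B ++ A).
Proof.
move=> nc a b ab; apply/negP => /subseq_catP[t1 [t2 [e sB sA]]].
have : subseq (t2 ++ t1) (A ++ B) by apply: cat_subseq.
have ba : b != a by rewrite eq_sym.
case: t1 e {sB} => [|c1 [|c2 [|c3 [|c4 [|]]]]] //=.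
- by move=> <-; apply/negP/nc.
- by case=> <- <-; apply/negP/nc.
- by case=> <- <- <-; apply/negP/nc.
- by case=> <- <- <- <-; apply/negP/nc.
by case=> <- <- <- <- <-; apply/negP/nc.
Qed.

(** Consecutive letters of [a b a b] differ, so an occurrence of the pattern
uses at most one of two equal neighbours. *)
Lemma noncrossing_dup A c B :
  noncrossing (A ++ c :: B) -> noncrossing (A ++ c :: c :: B).
Proof.
move=> nc a b ab; apply/negP => /subseq_catP[t1 [t2' [e sA]]].
rewrite -[c :: c :: B]/([:: c; c] ++ B).
case/subseq_catP=> t2 [t3 [e' sc sB]].
have : t2 = [:: c; c] \/ subseq t2 [:: c].
  case: t2 sc {e'} => [|d [|d' [|d'' t]]]; try by right.
  - by move=> /mem_subseq sc; right; rewrite sub1seq;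
    move: (sc d); rewrite !inE orbb => ->.
  - by move=> /size_subseq_leqif /leqifP; case: eqP => // ->; left.
  by move/size_subseq.
case=> [e2|s2]; last first.
  case/negP: (nc _ _ ab); rewrite e e' -[c :: B]/([:: c] ++ B).
  by rewrite !cat_subseq.
move: e; rewrite e' e2.
case: t1 {sA} => [|d1 [|d2 [|d3 [|d4 [|]]]]] //=.
- by case=> <- h; rewrite h eqxx in ab.
- by case=> _ <- h; rewrite h eqxx in ab.
by case=> _ _ <- h; rewrite h eqxx in ab.
Qed.

(** If exactly one letter of the pattern [a b a b] belongs to [V], then both its
occurrences lie in the contiguous block [V], and so would the occurrence of
the other letter that separates them.  If both or none belong to [V], the
pattern occurs in [V] or in [A ++ B]. *)
Lemma noncrossing_insert A V B :
  noncrossing (A ++ B) -> noncrossing V -> {in V, forall c, c \notin A ++ B} ->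
  noncrossing (A ++ V ++ B).
Proof.
move=> ncAB ncV disj a b ab; apply/negP => sub.
have [aV|aV] := boolP (a \in V); have [bV|bV] := boolP (b \in V).
- have : subseq [:: a; b; a; b] (filter (mem V) (A ++ V ++ B)).
    by rewrite subseq_filter /= aV bV sub.
  rewrite !filter_cat (@eq_in_filter _ _ xpred0 A) ?filter_pred0 //; last first.
    move=> c cA; apply/negP => /disj; rewrite mem_cat cA //.
  rewrite (@eq_in_filter _ _ xpred0 B) ?filter_pred0 //; last first.
    move=> c cA; apply/negP => /disj; rewrite mem_cat cA orbT //.
  by rewrite (all_filterP _) ?cats0; [apply/negP/ncV|apply/allP].
- have := disj _ aV; rewrite mem_cat => /norP[aA aB].
  have [t1 [t2' [e sA]]] := subseq_catP sub.
  case/subseq_catP=> t2 [t3 [e' sV sB]]; move: e; rewrite {}e'.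
  case: t1 sA => [_|d t1 /mem_subseq sA /= [e _]]; last first.
    by rewrite e sA ?mem_head in aA.
  case: t2 sV => [_ /= e|d [|d' t2]].
  - by rewrite (mem_subseq sB) // -e mem_head in aB.
  - by move=> _ /= [_ e]; rewrite (mem_subseq sB) // -e !inE eqxx orbT in aB.
  move/mem_subseq=> sV /= [_ e _].
  by rewrite e sV // !inE eqxx orbT in bV.
- have := disj _ bV; rewrite mem_cat => /norP[bA bB].
  have [t1 [t2' [e sA]]] := subseq_catP sub.
  case/subseq_catP=> t2 [t3 [e' sV sB]]; move: e; rewrite {}e'.
  case: t1 sA => [_|d [_|d' t1 /mem_subseq sA /= [_ e _]]]; last first.
  - by rewrite e sA ?inE ?eqxx ?orbT in bA.
  - case: t2 sV => [_ /= [_ e]|d' [|d2 t2]].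
    + by rewrite (mem_subseq sB) // -e mem_head in bB.
    + move=> _ /= [_ _ e]; rewrite (mem_subseq sB) // -e !inE eqxx orbT // in bB.
    move/mem_subseq=> sV /= [_ _ e _].
    by rewrite e sV // !inE eqxx orbT in aV.
  case: t2 sV => [_ /= e|d t2].
  - by rewrite (mem_subseq sB) // -e !inE eqxx orbT in bB.
  by move/mem_subseq=> sV /= [e _]; rewrite e sV // mem_head in aV.
have : subseq [:: a; b; a; b] (filter [predC V] (A ++ V ++ B)).
  by rewrite subseq_filter /= aV bV sub.
rewrite !filter_cat (@eq_in_filter _ _ xpred0 V) ?filter_pred0 //; last first.
  by move=> c /= ->.
apply/negP; apply: contra (ncAB _ _ ab) => /subseq_trans; apply.
by rewrite cat_subseq ?filter_subseq.
Qed.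

(** * Cyclic words *)

Definition cyclic_eq (u v : seq nat) := exists n, v = rot n u.

Lemma cyclic_eq_catC A B : cyclic_eq (A ++ B) (B ++ A).
Proof. by exists (size A); rewrite rot_size_cat. Qed.

Lemma cyclic_eq_cat u v :
  cyclic_eq u v -> exists A B, u = A ++ B /\ v = B ++ A.
Proof. by case=> n ->; exists (take n u), (drop n u); rewrite cat_take_drop. Qed.

Lemma cyclic_eq_sym u v : cyclic_eq u v -> cyclic_eq v u.
Proof. by case/cyclic_eq_cat=> A [B [-> ->]]; apply: cyclic_eq_catC. Qed.

Lemma cyclic_eq_trans u v w : cyclic_eq u v -> cyclic_eq v w -> cyclic_eq u w.
Proof. by case=> n -> [m ->]; rewrite rot_rot_add; eexists. Qed.

Lemma cyclic_eq_perm u v : cyclic_eq u v -> perm_eq u v.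
Proof. by case=> n ->; rewrite perm_sym perm_rot. Qed.

Lemma cyclic_eq_noncrossing u v : cyclic_eq u v -> noncrossing u -> noncrossing v.
Proof. by case/cyclic_eq_cat=> A [B [-> ->]]; apply: noncrossing_catC. Qed.

Lemma cyclic_eq_head a u : a \in u -> exists w, cyclic_eq u (a :: w).
Proof.
case/split_first=> A [B [-> _]]; exists (B ++ A).
exact: (cyclic_eq_catC A (a :: B)).
Qed.

(** A letter that occurs once marks the starting point of a cyclic word. *)
Lemma cyclic_eq_head_inj a w w' :
  a \notin w -> cyclic_eq (a :: w) (a :: w') -> w = w'.
Proof.
move=> aw /cyclic_eq_cat[[|b A] [B [e e']]];
  first by move: e e' => /= <-; rewrite cats0 => -[].
case: B e e' => [|c B] /= [e e1] [e' e2].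
  by rewrite e1 e2 cats0.
by rewrite e1 mem_cat -e' mem_head orbT in aw.
Qed.

(** The two ends are kept apart from [s] so that the count is additive when the
word is cut at a letter, and is the cyclic count of [a :: s] when [b = a]. *)
Fixpoint links (r : rel nat) (a : nat) (s : seq nat) (b : nat) : nat :=
  if s is c :: s' then r a c + links r c s' b else r a b.

Lemma links_cat r a s c t b :
  links r a (s ++ c :: t) b = links r a s c + links r c t b.
Proof. by elim: s a => [|d s IHs] a //=; rewrite IHs addnA. Qed.

Lemma links_rot r a w b v :
  cyclic_eq (a :: w) (b :: v) -> links r a w a = links r b v b.
Proof.
case/cyclic_eq_cat=> [[|a' A] [[|b' B] []]] /=; rewrite ?cats0 //.
- by case=> -> -> [-> ->].
- by case=> -> -> [-> ->].
by case=> -> -> [-> ->]; rewrite !links_cat addnC.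
Qed.

Lemma links_card (r : rel nat) w :
  #|[set i : 'I_(size w).+1 | r (nth 0 (padded w) i) (nth 0 (padded w) i.+1)]|
  = links r 0 w 0.
Proof.
rewrite -sum1dep_card big_mkcond /padded /=.
have E a : \sum_(i < (size w).+1)
    (if r (nth 0 (a :: rcons w 0) i) (nth 0 (a :: rcons w 0) i.+1) then 1 else 0)
    = links r a w 0.
  elim: w a => [|c w IHw] a /=; first by rewrite big_ord1 /=; case: r.
  by rewrite big_ord_recl IHw /=; case: (r a c).
exact: E.
Qed.

(** * Sliding a branch from one letter to another *)

(** Only the cyclic class of [u] matters: [R] is whatever completes the circle,
and the letter [0] may end up in any of the pieces. *)
Definition slide (x y : nat) (u u' : seq nat) :=
  exists V Y R, [/\ u = x :: V ++ x :: Y ++ y :: R,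
                    u' = x :: Y ++ y :: V ++ y :: R,
                    x \notin V, x \notin Y & y \notin Y].

(** A letter occurring both inside and outside would give [x c x c]. *)
Lemma enclosed_notin x V W c :
  noncrossing (x :: V ++ x :: W) -> x \notin V -> c \in V -> c \notin x :: W.
Proof.
move=> nc xV cV; have xc : x != c by apply: contraNneq xV => ->.
rewrite inE eq_sym (negPf xc) /=; apply: contra (nc _ _ xc) => cW.
rewrite -[x :: V ++ _]/([:: x] ++ V ++ [:: x] ++ W).
rewrite -[[:: x; c; x; c]]/([:: x] ++ [:: c] ++ [:: x] ++ [:: c]).
by rewrite !cat_subseq ?sub1seq ?inE.
Qed.

Lemma slide_noncrossing x y u u' :
  slide x y u u' -> noncrossing u -> noncrossing u'.
Proof.
case=> V [Y [R [-> -> xV xY yY]]] nc.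
have -> : x :: Y ++ y :: V ++ y :: R = (x :: rcons Y y) ++ V ++ (y :: R).
  by rewrite /= cat_rcons.
apply: noncrossing_insert.
- rewrite /= cat_rcons; apply: (@noncrossing_dup (x :: Y)).
  apply: noncrossing_subseq nc; exact: (suffix_subseq (x :: V)).
- apply: noncrossing_subseq nc; rewrite -cat1s.
  exact: (subseq_trans (prefix_subseq _ _) (suffix_subseq _ _)).
move=> c cV; have := enclosed_notin nc xV cV.
by rewrite !(inE, mem_cat, mem_rcons) !negb_or; case/and4P=> -> -> -> ->.
Qed.

Lemma slide_perm x y u u' : slide x y u u' -> perm_eq (x :: u') (y :: u).
Proof.
case=> V [Y [R [-> -> _ _ _]]]; apply/permP => p /=.
by rewrite !count_cat /= !count_cat /=; lia.
Qed.

Definition adjacent (x y : nat) := (y == x.+1) || (x == y.+1).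

(** The relations on letters counted by the three statistics. *)
Definition order_rel (r : rel nat) :=
  [\/ r =2 ltn, r =2 gtn | r =2 eq_op].

(** No integer lies strictly between [x] and [y], so a letter other than these
two compares to [x] as it does to [y]; the empty [V] gives a plateau in both
cases. *)
Lemma links_adjacent r x y V : order_rel r -> adjacent x y ->
  x \notin V -> y \notin V -> links r x V x = links r y V y.
Proof.
move=> or adj.
have E c : x != c -> y != c -> (r x c = r y c) * (r c x = r c y).
  move: adj; rewrite /adjacent => adj xc yc.
  by case: or => or; rewrite !or /=; split; lia.
have E0 : r x x = r y y by case: or => or; rewrite !or /=; lia.
case: V => [|c V] /=; first by rewrite E0.
rewrite !inE !negb_or => /andP[xc xV] /andP[yc yV]; rewrite (E c) //; congr addn.
elim: V c xc yc xV yV => [|d V IHV] c xc yc /=; first by rewrite (E c).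
rewrite !inE !negb_or => /andP[xd xV] /andP[yd yV]; congr addn.
exact: IHV.
Qed.

Lemma slide_links r x y u u' :
  order_rel r -> adjacent x y -> noncrossing u -> slide x y u u' ->
  exists w w', [/\ u = x :: w, u' = x :: w' & links r x w x = links r x w' x].
Proof.
move=> or adj nc [V [Y [R [eu eu' xV xY yY]]]].
exists (V ++ x :: Y ++ y :: R), (Y ++ y :: V ++ y :: R); split=> //.
rewrite !links_cat (links_adjacent or adj xV); first by lia.
rewrite eu in nc; apply/negP => /(enclosed_notin nc xV).
by rewrite inE mem_cat inE eqxx !orbT.
Qed.

(** A noncrossing cyclic word has a single place where an [x] is followed, among
the letters [x] and [y], by a [y]: two such places would give [x y x y]. *)
Lemma noncrossing_cut_uniq x y Y T Y' T' : x != y ->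
  noncrossing (x :: Y ++ y :: T) -> x \notin Y -> x \notin Y' ->
  cyclic_eq (x :: Y ++ y :: T) (x :: Y' ++ y :: T') ->
  x :: Y ++ y :: T = x :: Y' ++ y :: T'.
Proof.
move=> xy nc xY xY' /cyclic_eq_cat[[|a A] [[|b B] []]]; rewrite ?cats0 //=;
  try by move=> -> ->.
move=> [ax e] [bx e']; move: ax bx e e' => <- <- e e'; case/negP: (nc _ _ xy); rewrite e.
have yA : y \in A by apply: mem_before xY (esym e).
have yB : y \in B by apply: mem_before xY' (esym e').
rewrite -[x :: A ++ _]/([:: x] ++ A ++ [:: x] ++ B).
rewrite -[[:: x; y; x; y]]/([:: x] ++ [:: y] ++ [:: x] ++ [:: y]).
by rewrite !cat_subseq ?sub1seq ?inE.
Qed.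

(** Cutting [u'] and [v'] at their unique factor [x Y y] identifies them as
words, and the pieces [Y] and [V] are then read off at the first two
occurrences of [y]. *)
Lemma slide_inj x y u v u' v' : x != y ->
  noncrossing u -> noncrossing v -> slide x y u u' -> slide x y v v' ->
  cyclic_eq u' v' -> u = v.
Proof.
move=> xy ncu ncv su [V2 [Y2 [R2 [ev -> xV2 xY2 yY2]]]].
have nc' := slide_noncrossing su ncu.
case: su nc' => V [Y [R [eu -> xV xY yY]]] nc' cuv.
case: (noncrossing_cut_uniq xy nc' xY xY2 cuv) => /split_first_inj[] // eY.
have yV Z W S w : w = x :: Z ++ x :: W ++ y :: S -> noncrossing w ->
    x \notin Z -> y \notin Z.
  move=> -> nc xZ; apply/negP => /(enclosed_notin nc xZ).
  by rewrite inE mem_cat inE eqxx !orbT.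
case/split_first_inj; [exact: yV eu ncu xV|exact: yV ev ncv xV2|].
by move=> eV eR; rewrite eu ev eY eV eR.
Qed.

Lemma slide_exists x y c : x != y -> noncrossing c ->
  1 < count_mem x c -> y \in c ->
  exists u u', cyclic_eq c u /\ slide x y u u'.
Proof.
move=> xy nc x2 yc.
(* Start anywhere at an [x]; the first [y] after it and the last [x] before
   that [y] delimit the factor [x Y y]. *)
have [s cs] : exists s, cyclic_eq c (x :: s).
  by apply: cyclic_eq_head; rewrite -has_pred1 has_count (ltn_trans _ x2).
have : y \in x :: s by rewrite -(perm_mem (cyclic_eq_perm cs)).
rewrite inE eq_sym (negPf xy) /= => /split_first[s1 [s2 [es ys1]]].
have [P [Y [eP xY]]] := split_last (mem_head x s1).
have yY : y \notin Y.
  have : y \notin x :: s1 by rewrite inE eq_sym negb_or xy.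
  by rewrite eP mem_cat inE !negb_or => /and3P[].
have cut : cyclic_eq c (x :: Y ++ y :: s2 ++ P).
  apply: cyclic_eq_trans cs _; rewrite es -cat_cons eP -catA.
  by have := cyclic_eq_catC P ((x :: Y) ++ y :: s2); rewrite -catA.
have xT : x \in s2 ++ P.
  rewrite -has_pred1 has_count; move: x2; rewrite (permP (cyclic_eq_perm cut)).
  have -> : count_mem x (x :: Y ++ y :: s2 ++ P) = (count_mem x (s2 ++ P)).+1.
    by rewrite /= eqxx count_cat (count_memPn xY) /= eq_sym (negPf xy).
  by [].
(* Cyclically, the last [x] of [s2 ++ P] is the one that precedes [x Y y]. *)
have [T [V [eT xV]]] := split_last xT.
exists (x :: V ++ x :: Y ++ y :: T), (x :: Y ++ y :: V ++ y :: T).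
split; last by exists V, Y, T.
apply: cyclic_eq_trans cut _; rewrite eT.
have := cyclic_eq_catC (x :: Y ++ y :: T) (x :: V).
by rewrite /= -!catA.
Qed.

(** * Equidistribution *)

Definition stat (w : seq nat) := (asc w, des w, plat w).

Definition equidistributed (M M' : seq nat) :=
  perm_eq [seq stat w | w <- QS M] [seq stat w | w <- QS M'].

Lemma mem_QS w M : (w \in QS M) = quasi_stirling w && perm_eq w M.
Proof. by rewrite mem_filter mem_permutations. Qed.

Lemma QS_uniq M : uniq (QS M).
Proof. by rewrite filter_uniq // permutations_uniq. Qed.

Lemma equidistributed_perm M M' : perm_eq M M' -> equidistributed M M'.
Proof. by move=> pM; apply: perm_map; apply: perm_filter; apply: perm_permutations. Qed.

(** The slide is a relation rather than a function, because a cyclic word has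
several representatives; the finiteness of [s] allows to choose an image for
each of its elements. *)
Lemma count_le_inj (T S : eqType) (f : T -> S) (R : T -> T -> Prop) (s t : seq T) :
  uniq s -> (forall a, a \in s -> exists b, [/\ b \in t, f b = f a & R a b]) ->
  (forall a a' b, a \in s -> a' \in s -> R a b -> R a' b -> a = a') ->
  forall v, count_mem v (map f s) <= count_mem v (map f t).
Proof.
move=> us ex inj v; rewrite !count_map -!size_filter.
have [g gP] : exists g : T -> T, forall a, a \in s ->
    [/\ g a \in t, f (g a) = f a & R a (g a)].
  elim: s {us inj} ex => [|c s IHs] ex; first by exists id.
  have [b bP] := ex c (mem_head _ _).
  have [a|g gP] := IHs; first by move=> as_; apply: ex; rewrite inE as_ orbT.
  exists (fun a => if a == c then b else g a) => a; rewrite inE.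
  by case: eqP => [-> //|_ /= /gP].
rewrite -(size_map g); apply: uniq_leq_size.
  rewrite map_inj_in_uniq ?filter_uniq // => a a'.
  rewrite !mem_filter => /andP[_ /[dup] aS /gP[_ _ Ra]]
    /andP[_ /[dup] aS' /gP[_ _ Ra']] e.
  by apply: inj aS aS' Ra _; rewrite e.
move=> _ /mapP[a + ->]; rewrite !mem_filter /= => /andP[fa /gP[-> -> _]].
by rewrite fa.
Qed.

(** Sliding is total on the source and injective, hence does not decrease the
number of words with given statistics. *)
Lemma transfer_le x y A : adjacent x y -> 0 \notin x :: A ->
  x \in A -> y \in A -> forall v,
  count_mem v [seq stat w | w <- QS (x :: A)]
  <= count_mem v [seq stat w | w <- QS (y :: A)].
Proof.
move=> adj; rewrite inE negb_or => /andP[x0 A0] xA yA.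
have xy : x != y by move: adj; rewrite /adjacent; lia.
have y0 : 0 != y by apply: contraNneq A0 => ->.
pose R w w' := exists u u', [/\ cyclic_eq (0 :: w) u, cyclic_eq u' (0 :: w'),
  noncrossing u & slide x y u u'].
have QSP w : w \in QS (x :: A) -> [/\ 0 \notin w, noncrossing (0 :: w)
    & perm_eq w (x :: A)].
  rewrite mem_QS => /andP[/quasi_stirlingP nc pw].
  have w0 : 0 \notin w by rewrite (perm_mem pw) inE negb_or x0.
  split=> //; apply: (@noncrossing_insert [::] [:: 0] w) => //.
    by move=> a b _; apply/negP => /size_subseq.
  by move=> c; rewrite inE => /eqP->.
apply: (@count_le_inj _ _ _ R); first exact: QS_uniq.
- move=> w /QSP[w0 nc0 pw].
  have [||u [u' [cu su]]] := slide_exists xy nc0.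
  + rewrite /= (negPf x0) (permP pw) /= eqxx add0n ltnS.
    by rewrite -has_count has_pred1.
  + by rewrite inE (perm_mem pw) inE yA !orbT.
  have ncu := cyclic_eq_noncrossing cu nc0.
  have pu := cyclic_eq_perm cu.
  have [|w' cw'] := @cyclic_eq_head 0 u'.
    have : 0 \in x :: u' by rewrite (perm_mem (slide_perm su)) inE -(perm_mem pu)
      mem_head orbT.
    by rewrite inE (negPf x0).
  exists w'; split; last by exists u, u'.
    rewrite mem_QS; apply/andP; split.
      apply/quasi_stirlingP.
      have := cyclic_eq_noncrossing cw' (slide_noncrossing su ncu).
      apply: noncrossing_subseq; exact: subseq_cons.
    apply/permP => p; have := permP (slide_perm su) p.
    have := permP (cyclic_eq_perm cw') p; have := permP pu p.
    have := permP pw p; rewrite /=; lia.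
  have L r : order_rel r -> links r 0 w' 0 = links r 0 w 0.
    move=> or; have [z [z' [ez ez' e]]] := slide_links or adj ncu su.
    move: cu cw'; rewrite ez ez' => /links_rot -> /links_rot <-.
    by rewrite e.
  rewrite /stat /asc /des /plat !(links_card ltn) !(links_card gtn).
  rewrite !(links_card eq_op) !L //.
  + by constructor 3.
  + by constructor 2.
  by constructor 1.
move=> w w2 w' /QSP[w0 _ _] _ [u [u' [cu cu' ncu su]]] [v [v' [cv cv' ncv sv]]].
apply: (cyclic_eq_head_inj w0); apply: cyclic_eq_trans cu _.
rewrite (slide_inj xy ncu ncv su sv); first exact: cyclic_eq_sym.
exact: cyclic_eq_trans cu' (cyclic_eq_sym cv').
Qed.

Lemma equidistributed_transfer x y A : adjacent x y -> 0 \notin A ->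
  x \in A -> y \in A -> equidistributed (x :: A) (y :: A).
Proof.
move=> adj A0 xA yA; apply/allP => v _; apply/eqP/anti_leq/andP.
have [x0 y0] : 0 != x /\ 0 != y by split; apply: contraNneq A0 => ->.
split; apply: transfer_le => //; rewrite ?inE ?negb_or ?x0 ?y0 //.
by rewrite /adjacent orbC.
Qed.

Lemma equidistributed_trans M1 M2 M3 :
  equidistributed M1 M2 -> equidistributed M2 M3 -> equidistributed M1 M3.
Proof. exact: perm_trans. Qed.

Lemma equidistributed_lower n A x : 0 \notin A -> {subset iota 1 n <= A} ->
  1 <= x <= n -> equidistributed (x :: A) (1 :: A).
Proof.
move=> A0 sA; elim: x => // x IHx xn.
have [->|x0] := eqVneq x 0; first exact: perm_refl.
apply: equidistributed_trans (IHx _); last by lia.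
by apply: equidistributed_transfer; rewrite ?/adjacent ?eqxx ?orbT //;
  apply: sA; rewrite mem_iota; lia.
Qed.

(** Letters that have already been lowered to [1] join the fixed part [A],
which is why [A] is only required to contain [1..n]. *)
Lemma equidistributed_collapse n A E : 0 \notin A -> {subset iota 1 n <= A} ->
  {subset E <= iota 1 n} ->
  equidistributed (A ++ E) (A ++ nseq (size E) 1).
Proof.
elim: E A => [|e E IHE] A A0 sA sE /=; first exact: perm_refl.
have en : 1 <= e <= n by have := sE e (mem_head _ _); rewrite mem_iota; lia.
have sE' : {subset E <= iota 1 n} by move=> c cE; apply: sE; rewrite inE cE orbT.
apply: (@equidistributed_trans _ (e :: A ++ E)).
  by apply: equidistributed_perm; rewrite perm_catC /= perm_cons perm_catC.
apply: (@equidistributed_trans _ (1 :: A ++ E)).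
  apply: (equidistributed_lower (n := n)) en.
    by rewrite mem_cat negb_or A0; apply/negP => /sE'; rewrite mem_iota.
  by move=> c /sA; rewrite mem_cat => ->.
apply: (@equidistributed_trans _ ((1 :: A) ++ nseq (size E) 1)).
  apply: (IHE (1 :: A)) => //.
  by move=> c /sA; rewrite inE orbC => ->.
by apply: equidistributed_perm; rewrite perm_sym perm_catC /= perm_cons perm_catC.
Qed.

(** The surplus copies, once one copy of each letter is set aside. *)
Definition excess (n : nat) (k : nat -> nat) := multiset n (fun i => (k i).-1).

Lemma multiset_excess n k : (forall i, 1 <= i <= n -> 1 <= k i) ->
  perm_eq (multiset n k) (iota 1 n ++ excess n k).
Proof.
move=> k1; rewrite /excess /multiset.
have {k1} : {in iota 1 n, forall i, 0 < k i}.
  by move=> i; rewrite mem_iota => /k1.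
elim: (iota 1 n) => //= c s IHs kP; apply/permP => p.
have /permP/(_ p) : perm_eq (flatten [seq nseq (k i) i | i <- s])
    (s ++ flatten [seq nseq (k i).-1 i | i <- s]).
  by apply: IHs => i si; apply: kP; rewrite inE si orbT.
have := kP c (mem_head _ _); case: (k c) => //= k' _.
by rewrite !count_cat /=; lia.
Qed.

Lemma size_multiset n k : size (multiset n k) = \sum_(1 <= i < n.+1) k i.
Proof.
rewrite /multiset size_flatten /shape -map_comp sumnE big_map.
rewrite /index_iota subn1; apply: eq_bigr => i _; exact: size_nseq.
Qed.

Lemma equidistributed_multiset n k k' :
  (forall i, 1 <= i <= n -> 1 <= k i) -> (forall i, 1 <= i <= n -> 1 <= k' i) ->
  \sum_(1 <= i < n.+1) k i = \sum_(1 <= i < n.+1) k' i ->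
  equidistributed (multiset n k) (multiset n k').
Proof.
move=> k1 k1' eK.
have N l : (forall i, 1 <= i <= n -> 1 <= l i) -> equidistributed (multiset n l)
    (iota 1 n ++ nseq (\sum_(1 <= i < n.+1) l i - n) 1).
  move=> l1; have pl := multiset_excess l1.
  apply: equidistributed_trans (equidistributed_perm pl) _.
  have -> : \sum_(1 <= i < n.+1) l i - n = size (excess n l).
    by rewrite -size_multiset (perm_size pl) size_cat size_iota addKn.
  apply: (equidistributed_collapse (n := n)) => //; first by rewrite mem_iota.
  move=> c /flatten_mapP[i + ]; rewrite mem_nseq => ni /andP[_ /eqP->] //.
apply: equidistributed_trans (N _ k1) _; rewrite eK.
by rewrite /equidistributed perm_sym; apply: N.
Qed.

(** Rearranging [t] into [t'] so that [f] takes the same values along [s] and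
[t'], the bijection matches equal positions. *)
Lemma map_perm_bij (T S : eqType) (f : T -> S) (s t : seq T) :
  uniq s -> uniq t -> perm_eq (map f s) (map f t) ->
  exists Phi : {a : T | a \in s} -> {a : T | a \in t},
    bijective Phi /\ forall a, f (val a) = f (val (Phi a)).
Proof.
case: s => [|x0 s0]; last set s := x0 :: s0.
  move=> _ _; case: t => [_|c t]; last by move/perm_size.
  by exists id; split=> //; exists id.
move=> us ut /(perm_iotaP (f x0))[Is pIs eIs].
pose t' := [seq nth x0 t i | i <- Is].
have pt : perm_eq t' t.
  apply/(perm_iotaP x0); exists Is => //; by rewrite size_map in pIs.
have ft : map f s = map f t'.
  rewrite eIs -[RHS]map_comp; apply/eq_in_map.
  move=> i; rewrite (perm_mem pIs) mem_iota size_map /= => ilt.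
  by rewrite (nth_map x0).
have ut' : uniq t' by rewrite (perm_uniq pt).
have sz : size s = size t' by rewrite -(size_map f s) ft size_map.
pose g a := nth x0 t' (index a s); pose h b := nth x0 s (index b t').
have gP (a : {a : T | a \in s}) : g (val a) \in t.
  by rewrite -(perm_mem pt) mem_nth // -sz index_mem (valP a).
have hP (b : {b : T | b \in t}) : h (val b) \in s.
  by rewrite mem_nth // sz index_mem (perm_mem pt) (valP b).
exists (fun a => exist _ (g (val a)) (gP a)); split.
  exists (fun b => exist _ (h (val b)) (hP b)) => [a|b]; apply: val_inj => /=.
    by rewrite /h /g index_uniq ?nth_index ?(valP a) // -sz index_mem (valP a).
  have bt : val b \in t' by rewrite (perm_mem pt) (valP b).
  by rewrite /h /g index_uniq ?nth_index // sz index_mem.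
move=> a /=; rewrite /g.
have ia : index (val a) s < size s by rewrite index_mem (valP a).
by rewrite -(nth_map x0 (f x0)) -?sz // -ft (nth_map x0) // nth_index // (valP a).
Qed.

Theorem theorem1p1 (n : nat) (k : nat -> nat)
    (n_ge1 : 1 <= n) (k_ge1 : forall i : nat, 1 <= i <= n -> 1 <= k i) :
  let K := \sum_(1 <= i < n.+1) k i in
  let M := multiset n k in
  let M' := multiset n (fun i => if i == 1 then K - n + 1 else 1) in
  (exists Phi : {w : seq nat | w \in QS M} -> {w : seq nat | w \in QS M'},
      bijective Phi /\
      forall pi : {w : seq nat | w \in QS M},
        [/\ asc (val pi) = asc (val (Phi pi)),
            des (val pi) = des (val (Phi pi))
          & plat (val pi) = plat (val (Phi pi))])
  /\ Qbar M = Qbar M'.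
Proof.
move=> K M M'.
have nK : n <= K.
  rewrite -[n in n <= _]subn0 -(subSS 0 n) -[_ - 1]muln1 -sum_nat_const_nat.
  by rewrite /K !big_nat; apply: leq_sum => i; rewrite ltnS => /k_ge1.
have eqd : equidistributed M M'.
  apply: equidistributed_multiset => // [i _|]; first by case: eqP => _; lia.
  rewrite -/K big_ltn // eqxx big_nat (eq_bigr (fun=> 1)); last first.
    by move=> i; case: eqP => // ->.
  by rewrite -big_nat sum_nat_const_nat; lia.
split.
  have [Phi [bPhi ePhi]] := map_perm_bij (QS_uniq M) (QS_uniq M') eqd.
  by exists Phi; split=> // pi; case: (ePhi pi) => -> -> ->.
pose F v := (var_t ^+ v.1.2 * var_u ^+ v.1.1 * var_v ^+ v.2)%R.
have QE N : Qbar N = (\sum_(v <- [seq stat w | w <- QS N]) F v)%R.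
  by rewrite big_map.
by rewrite !QE; apply: perm_big.
Qed.
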